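(* Let $l_1,l_1',l_2,l_2'\in\mathbb N$ and $x\in\mathbb C$ be arbitrary, and let $m_1,m_1',m_2,m_2'$ be integers with $|m_1|\le l_1$, $|m_1'|\le l_1'$, $|m_2|\le l_2$, $|m_2'|\le l_2'$. (i) For $m_2\ne m_2'$ we have $$MC(e_{l_1m_1},e_{l_2m_2}+x\,e_{l_2'm_2'})=MC(e_{l_1m_1},e_{l_2m_2})+|x|^2MC(e_{l_1m_1},e_{l_2'm_2'}).$$ (ii) For $m_1\ne m_1'$ we have $$MC(e_{l_1m_1}+x\,e_{l_1'm_1'},e_{l_2m_2})=MC(e_{l_1m_1},e_{l_2m_2})+|x|^2MC(e_{l_1'm_1'},e_{l_2m_2}).$$
   Context: Use coordinates $(\lambda,\mu)\in(0,2\pi)\times(-1,1)$ on the unit sphere $\mathbb S^2$ ($\lambda$ longitude, $\mu$ height), with area element $d\lambda\,d\mu$ and Laplace–Beltrami operator $\Delta$. The Poisson bracket is $\{f,g\}=\partial_\lambda f\,\partial_\mu g-\partial_\mu f\,\partial_\lambda g$, extended complex-bilinearly to complex-valued functions, and $\langle f,g\rangle=\int_{\mathbb S^2} f\,g^*\,d\lambda\,d\mu$, where $^*$ is complex conjugation. For integers $l\ge 0$, $|m|\le l$, $Y_{lm}$ denotes the complex spherical harmonic: for $m\ge 0$, $Y_{lm}=(-1)^m\sqrt{\frac{2l+1}{4\pi}\frac{(l-m)!}{(l+m)!}}\,P_l^m(\mu)e^{im\lambda}$ with $P_l^m(\mu)=\frac{(1-\mu^2)^{m/2}}{2^l l!}\frac{d^{l+m}}{d\mu^{l+m}}(\mu^2-1)^l$,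 and $Y_{l\,-m}=(-1)^mY_{lm}^*$. These are orthonormal with $\Delta Y_{lm}=-l(l+1)Y_{lm}$. Put $\nabla^\perp f=(-\partial_\mu f,\partial_\lambda f)$ and $e_{lm}=\nabla^\perp Y_{lm}$. The Misiolek criterion of $u=\nabla^\perp f$, $v=\nabla^\perp g$ ($f,g$ complex-valued) is $MC(u,v)=\langle\Delta\{f,g\},\{f,g\}\rangle-\langle\{\Delta f,g\},\{f,g\}\rangle.$ *)

(* Defs.v *)
From Stdlib Require Export Reals ZArith.
From Stdlib Require Import Lra.
From Coquelicot Require Export Coquelicot.

Open Scope R_scope.

(* Functions on the sphere are written in the coordinates
   (lam, mu) in (0, 2 PI) x (-1, 1).  They are total on R * R; their values
   outside the chart play no role. *)
Definition sfun := R -> R -> C.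

(* Components in the order used by the skew gradient, (- d_mu f, d_lam f). *)
Definition vfield := R -> R -> C * C.

Definition in_chart (lam mu : R) : Prop := 0 < lam < 2 * PI /\ -1 < mu < 1.

(* Derivatives of C-valued functions of a real variable.  [Derive] is total,
   so differentiability is stated separately. *)
Definition CDerive (f : R -> C) (t : R) : C :=
  (Derive (fun s => Re (f s)) t, Derive (fun s => Im (f s)) t).

Definition ex_Cderive (f : R -> C) (t : R) : Prop :=
  ex_derive (fun s => Re (f s)) t /\ ex_derive (fun s => Im (f s)) t.

Definition d_lam (f : sfun) : sfun := fun lam mu => CDerive (fun s => f s mu) lam.
Definition d_mu (f : sfun) : sfun := fun lam mu => CDerive (fun s => f lam s) mu.

Definition chart_diff (f : sfun) : Prop :=
  forall lam mu, in_chart lam mu ->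
    ex_Cderive (fun s => f s mu) lam /\ ex_Cderive (fun s => f lam s) mu.

(* Laplace-Beltrami operator of the round metric
   (1 - mu^2) dlam^2 + dmu^2 / (1 - mu^2). *)
Definition laplacian (f : sfun) : sfun := fun lam mu =>
  (RtoC (/ (1 - mu ^ 2)) * d_lam (d_lam f) lam mu
   + d_mu (fun lam' mu' => RtoC (1 - mu' ^ 2) * d_mu f lam' mu') lam mu)%C.

Definition poisson (f g : sfun) : sfun := fun lam mu =>
  (d_lam f lam mu * d_mu g lam mu - d_mu f lam mu * d_lam g lam mu)%C.

(* The area element is dlam dmu; the integrals below are applied to functions
   that are smooth on the sphere, hence bounded and continuous on the chart. *)
Definition sphere_int (h : sfun) : C :=
  RInt (V := C_R_CompleteNormedModule)
    (fun mu => RInt (V := C_R_CompleteNormedModule)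
                 (fun lam => h lam mu) 0 (2 * PI)) (-1) 1.

Definition inner (f g : sfun) : C :=
  sphere_int (fun lam mu => (f lam mu * Cconj (g lam mu))%C).

Definition gradperp (f : sfun) : vfield := fun lam mu =>
  ((- d_mu f lam mu)%C, d_lam f lam mu).

Definition vadd (u v : vfield) : vfield := fun lam mu =>
  ((fst (u lam mu) + fst (v lam mu))%C, (snd (u lam mu) + snd (v lam mu))%C).

Definition vscal (x : C) (u : vfield) : vfield := fun lam mu =>
  ((x * fst (u lam mu))%C, (x * snd (u lam mu))%C).

Definition is_stream (f : sfun) (u : vfield) : Prop :=
  chart_diff f /\
  forall lam mu, in_chart lam mu -> u lam mu = gradperp f lam mu.

Definition MC_stream (f g : sfun) : C :=
  (inner (laplacian (poisson f g)) (poisson f g)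
   - inner (poisson (laplacian f) g) (poisson f g))%C.

(* The Misiolek criterion is a function of the vector fields: the unique value
   of [MC_stream] over all their stream functions ([MC_streamE] below shows
   that it does not depend on the choice).  It is unspecified for fields
   that have no stream function. *)
Definition MC (u v : vfield) : C :=
  iota (T := C_R_CompleteNormedModule)
    (fun c : C => exists f g : sfun,
       is_stream f u /\ is_stream g v /\ c = MC_stream f g).

Definition legendre (l m : nat) (mu : R) : R :=
  Rpower (1 - mu ^ 2) (INR m / 2) / (2 ^ l * INR (fact l))
  * Derive_n (fun t => (t ^ 2 - 1) ^ l) (l + m) mu.

Definition expi (t : R) : C := (cos t, sin t).

Definition Ynonneg (l m : nat) : sfun := fun lam mu =>
  (RtoC ((-1) ^ m
         * sqrt ((2 * INR l + 1) / (4 * PI)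
                 * (INR (fact (l - m)) / INR (fact (l + m))))
         * legendre l m mu)
   * expi (INR m * lam))%C.

(* Meaningful for |m| <= l only. *)
Definition Y (l : nat) (m : Z) : sfun :=
  if (0 <=? m)%Z then Ynonneg l (Z.abs_nat m)
  else fun lam mu =>
    (RtoC ((-1) ^ Z.abs_nat m) * Cconj (Ynonneg l (Z.abs_nat m) lam mu))%C.

Definition e (l : nat) (m : Z) : vfield := gradperp (Y l m).

Definition chart_eq (f g : sfun) : Prop :=
  forall lam mu, in_chart lam mu -> f lam mu = g lam mu.

Lemma locally_between (a b t : R) : a < t < b -> locally t (fun s => a < s < b).
Proof.
intros H; apply (open_and (fun s => a < s) (fun s => s < b)); auto.
- apply open_gt.
- apply open_lt.
Qed.

Lemma CDerive_ext_loc (f g : R -> C) (t : R) :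
  locally t (fun s => f s = g s) -> CDerive f t = CDerive g t.
Proof.
intros H; unfold CDerive; f_equal; apply Derive_ext_loc;
  revert H; apply filter_imp; intros s ->; reflexivity.
Qed.

Lemma d_lam_ext (f g : sfun) : chart_eq f g -> chart_eq (d_lam f) (d_lam g).
Proof.
intros H lam mu [Hl Hm]; apply CDerive_ext_loc.
generalize (locally_between _ _ _ Hl); apply filter_imp; intros s Hs.
apply H; split; assumption.
Qed.

Lemma d_mu_ext (f g : sfun) : chart_eq f g -> chart_eq (d_mu f) (d_mu g).
Proof.
intros H lam mu [Hl Hm]; apply CDerive_ext_loc.
generalize (locally_between _ _ _ Hm); apply filter_imp; intros s Hs.
apply H; split; assumption.
Qed.

Lemma sphere_int_ext (f g : sfun) : chart_eq f g -> sphere_int f = sphere_int g.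
Proof.
intros H; unfold sphere_int; apply (RInt_ext (V := C_R_CompleteNormedModule));
  rewrite Rmin_left, Rmax_right by lra.
intros mu Hm; apply (RInt_ext (V := C_R_CompleteNormedModule)).
assert (HP := PI_RGT_0); rewrite Rmin_left, Rmax_right by lra.
intros lam Hl; apply H; split; assumption.
Qed.

Lemma MC_stream_ext (f f' g g' : sfun) :
  chart_eq (d_lam f) (d_lam f') -> chart_eq (d_mu f) (d_mu f') ->
  chart_eq (d_lam g) (d_lam g') -> chart_eq (d_mu g) (d_mu g') ->
  MC_stream f g = MC_stream f' g'.
Proof.
intros Hfl Hfm Hgl Hgm.
assert (Hp : chart_eq (poisson f g) (poisson f' g')).
{ intros lam mu H; unfold poisson.
  rewrite Hfl, Hfm, Hgl, Hgm by assumption; reflexivity. }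
assert (HL : forall h h', chart_eq (d_lam h) (d_lam h') ->
  chart_eq (d_mu h) (d_mu h') -> chart_eq (laplacian h) (laplacian h')).
{ intros h h' H1 H2 lam mu H; unfold laplacian; apply f_equal2.
  - rewrite (d_lam_ext _ _ H1) by assumption; reflexivity.
  - apply d_mu_ext; [|assumption].
    intros lam' mu' H'; rewrite H2 by assumption; reflexivity. }
unfold MC_stream, inner; apply f_equal2; apply sphere_int_ext;
  intros lam mu H; apply f_equal2; try (rewrite Hp by assumption; reflexivity).
- apply HL; auto using d_lam_ext, d_mu_ext.
- assert (HLf := HL _ _ Hfl Hfm); unfold poisson.
  rewrite (d_lam_ext _ _ HLf), (d_mu_ext _ _ HLf), Hgl, Hgm by assumption.
  reflexivity.
Qed.

Lemma is_stream_unique (f f' : sfun) (u : vfield) :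
  is_stream f u -> is_stream f' u ->
  chart_eq (d_lam f) (d_lam f') /\ chart_eq (d_mu f) (d_mu f').
Proof.
intros [_ H] [_ H']; split; intros lam mu Hc;
  specialize (H _ _ Hc); rewrite (H' _ _ Hc) in H; unfold gradperp in H.
- symmetry; exact (f_equal snd H).
- apply (f_equal fst) in H; simpl in H.
  replace (d_mu f lam mu) with (- - d_mu f lam mu)%C by ring.
  rewrite <- H; ring.
Qed.

Lemma MC_streamE (f g : sfun) (u v : vfield) :
  is_stream f u -> is_stream g v -> MC u v = MC_stream f g.
Proof.
intros Hf Hg; unfold MC.
apply (iota_unique (V := C_R_CompleteNormedModule)).
- intros c (f' & g' & Hf' & Hg' & ->).
  destruct (is_stream_unique _ _ _ Hf' Hf).
  destruct (is_stream_unique _ _ _ Hg' Hg).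
  apply MC_stream_ext; assumption.
- exists f, g; auto.
Qed.

(* Main.v *)
Require Import Defs.
From Stdlib Require Import Reals ZArith.
From Coquelicot Require Import Coquelicot.
From Stdlib Require Import Lra Lia.

(* Call a function a mode of frequency k if it is (1 - mu^2)^(|k|/2) p(mu) e^(i k lam) with p a
   polynomial.  Y_lm is a mode of frequency m, the Laplacian preserves the frequency, and the Poisson
   bracket of modes of frequencies k and n is a mode of frequency k + n.  Modes of different
   frequencies are orthogonal, because already the longitude integral vanishes.  So when
   {f, g + x g'} is expanded with g and g' of different frequencies, both inner products in MC
   lose their cross terms, and the same holds for {f + x f', g}. *)

(** * Polynomial functions of one real variable *)

Inductive is_poly : (R -> R) -> Prop :=
| is_poly_const (c : R) : is_poly (fun _ => c)
| is_poly_id : is_poly (fun t => t)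
| is_poly_plus (p q : R -> R) : is_poly p -> is_poly q -> is_poly (fun t => p t + q t)
| is_poly_mult (p q : R -> R) : is_poly p -> is_poly q -> is_poly (fun t => p t * q t).

Lemma is_poly_pow (p : R -> R) (n : nat) : is_poly p -> is_poly (fun t => p t ^ n).
Proof. intros Hp; induction n; simpl; constructor; assumption. Qed.

(** [is_poly] matches functions up to conversion and has no constructor for subtraction, hence this
    spelling of [1 - t ^ 2] here and below. *)
Lemma is_poly_one_minus_sqr : is_poly (fun t => 1 + (-1) * t ^ 2).
Proof. repeat (constructor || apply is_poly_pow). Qed.

Lemma is_poly_derive (p : R -> R) :
  is_poly p -> exists p', is_poly p' /\ forall t, is_derive p t (p' t).
Proof.
induction 1 as [c | | p q Hp [p' [Pp Dp]] Hq [q' [Pq Dq]] | p q Hp [p' [Pp Dp]] Hq [q' [Pq Dq]]].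
- exists (fun _ => 0); split; [constructor | intros t; apply (is_derive_const (V := R_NormedModule))].
- exists (fun _ => 1); split; [constructor | intros t; apply (is_derive_id (K := R_AbsRing))].
- exists (fun t => p' t + q' t); split; [constructor; assumption|].
  intros t; apply (is_derive_plus (V := R_NormedModule)); auto.
- exists (fun t => p' t * q t + p t * q' t); split; [repeat constructor; assumption|].
  intros t; apply (is_derive_mult (K := R_AbsRing)); auto.
  intros; apply Rmult_comm.
Qed.

(** Meant for [(t ^ 2 - 1) ^ l], whose iterated derivative is the Rodrigues factor of [legendre]. *)
Lemma is_poly_Derive_n (p : R -> R) (n : nat) :
  is_poly p -> exists q, is_poly q /\ forall t, Derive_n p n t = q t.
Proof.
intros Hp; induction n as [|n [q [Hq E]]]; [exists p; auto|].
destruct (is_poly_derive q Hq) as [q' [Hq' D]].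
exists q'; split; [assumption|]; intros t; simpl.
rewrite (Derive_ext _ q) by assumption; apply is_derive_unique, D.
Qed.

Lemma ex_RInt_poly (p : R -> R) (a b : R) : is_poly p -> ex_RInt p a b.
Proof.
intros Hp; apply (ex_RInt_continuous (V := R_CompleteNormedModule)); intros t _.
destruct (is_poly_derive p Hp) as [p' [_ D]].
apply (ex_derive_continuous (K := R_AbsRing) (V := R_NormedModule)).
exists (p' t); apply D.
Qed.

(** * Derivatives of complex-valued functions of a real variable *)

Definition is_Cderive (f : R -> C) (t : R) (v : C) : Prop :=
  is_derive (fun s => Re (f s)) t (Re v) /\ is_derive (fun s => Im (f s)) t (Im v).

Lemma is_Cderive_unique (f : R -> C) (t : R) (v : C) : is_Cderive f t v -> CDerive f t = v.
Proof.
intros [H1 H2]; destruct v as [a b].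
unfold CDerive; apply f_equal2; apply is_derive_unique; assumption.
Qed.

Lemma is_Cderive_ex (f : R -> C) (t : R) (v : C) : is_Cderive f t v -> ex_Cderive f t.
Proof. intros [H1 H2]; split; eexists; eassumption. Qed.

Lemma ex_Cderive_correct (f : R -> C) (t : R) : ex_Cderive f t -> is_Cderive f t (CDerive f t).
Proof. intros [H1 H2]; split; apply Derive_correct; assumption. Qed.

Lemma ex_Cderive_ext_loc (f g : R -> C) (t : R) :
  locally t (fun s => f s = g s) -> ex_Cderive f t -> ex_Cderive g t.
Proof.
intros H [H1 H2]; split; [revert H1 | revert H2]; apply ex_derive_ext_loc;
  revert H; apply filter_imp; intros s ->; reflexivity.
Qed.

Lemma is_Cderive_lincomb (f g : R -> C) (x : C) (t : R) (u v : C) :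
  is_Cderive f t u -> is_Cderive g t v ->
  is_Cderive (fun s => (f s + x * g s)%C) t (u + x * v)%C.
Proof.
intros [Hf1 Hf2] [Hg1 Hg2]; destruct x as [a b]; split; simpl.
- apply (is_derive_plus (V := R_NormedModule)); [exact Hf1|].
  apply (is_derive_minus (V := R_NormedModule));
    apply is_derive_scal; assumption.
- apply (is_derive_plus (V := R_NormedModule)); [exact Hf2|].
  apply (is_derive_plus (V := R_NormedModule));
    apply is_derive_scal; assumption.
Qed.

Lemma is_Cderive_real (z : C) (a : R -> R) (t a' : R) :
  is_derive a t a' -> is_Cderive (fun s => (z * RtoC (a s))%C) t (z * RtoC a')%C.
Proof.
intros Ha; destruct z as [p q]; split; simpl;
  auto_derive; try (repeat split; exists a'; exact Ha);
  change (fun s : R => a s) with a; rewrite (is_derive_unique _ _ _ Ha); ring.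
Qed.

Lemma is_Cderive_expi (z : C) (k t : R) :
  is_Cderive (fun s => (z * expi (k * s))%C) t (z * (0, k) * expi (k * t))%C.
Proof. destruct z as [p q]; split; simpl; auto_derive; auto; ring. Qed.

(** * Linearity of the Laplacian and of the Poisson bracket *)

Definition lincomb (f : sfun) (x : C) (g : sfun) : sfun :=
  fun lam mu => (f lam mu + x * g lam mu)%C.

Lemma chart_diff_lincomb (f g : sfun) (x : C) :
  chart_diff f -> chart_diff g -> chart_diff (lincomb f x g).
Proof.
intros Hf Hg lam mu H; destruct (Hf _ _ H), (Hg _ _ H); unfold lincomb.
split; eapply is_Cderive_ex;
  apply (is_Cderive_lincomb (fun s => f _ _) (fun s => g _ _));
  apply ex_Cderive_correct; assumption.
Qed.

Lemma d_lam_lincomb (f g : sfun) (x : C) : chart_diff f -> chart_diff g ->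
  chart_eq (d_lam (lincomb f x g)) (lincomb (d_lam f) x (d_lam g)).
Proof.
intros Hf Hg lam mu H; destruct (Hf _ _ H), (Hg _ _ H).
apply is_Cderive_unique, (is_Cderive_lincomb (fun s => f s mu) (fun s => g s mu));
  apply ex_Cderive_correct; assumption.
Qed.

Lemma d_mu_lincomb (f g : sfun) (x : C) : chart_diff f -> chart_diff g ->
  chart_eq (d_mu (lincomb f x g)) (lincomb (d_mu f) x (d_mu g)).
Proof.
intros Hf Hg lam mu H; destruct (Hf _ _ H), (Hg _ _ H).
apply is_Cderive_unique, (is_Cderive_lincomb (fun s => f lam s) (fun s => g lam s));
  apply ex_Cderive_correct; assumption.
Qed.

Definition weighted_d_mu (f : sfun) : sfun :=
  fun lam mu => (RtoC (1 - mu ^ 2) * d_mu f lam mu)%C.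

Lemma weighted_d_mu_ext (f g : sfun) :
  chart_eq f g -> chart_eq (weighted_d_mu f) (weighted_d_mu g).
Proof. intros H lam mu Hc; unfold weighted_d_mu; rewrite (d_mu_ext f g) by assumption; reflexivity. Qed.

Lemma chart_weight_pos (lam mu : R) : in_chart lam mu -> 0 < 1 - mu ^ 2.
Proof. intros [_ H]; nra. Qed.

(** [Derive] is additive only on differentiable functions, so each of the two orders of
    differentiation brings its own hypotheses: on [f] and [g] for the first, on [d_lam] and
    [weighted_d_mu] of them for the second. *)
Lemma laplacian_lincomb (f g : sfun) (x : C) :
  chart_diff f -> chart_diff g -> chart_diff (d_lam f) -> chart_diff (d_lam g) ->
  chart_diff (weighted_d_mu f) -> chart_diff (weighted_d_mu g) ->
  chart_eq (laplacian (lincomb f x g)) (lincomb (laplacian f) x (laplacian g)).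
Proof.
intros Hf Hg Hfl Hgl Hfm Hgm lam mu H; unfold laplacian.
rewrite (d_lam_ext _ _ (d_lam_lincomb f g x Hf Hg)) by assumption.
rewrite d_lam_lincomb by assumption.
fold (weighted_d_mu (lincomb f x g)).
rewrite (d_mu_ext _ (lincomb (weighted_d_mu f) x (weighted_d_mu g))).
- rewrite d_mu_lincomb by assumption; unfold lincomb, weighted_d_mu; ring.
- intros lam' mu' H'; unfold weighted_d_mu.
  rewrite d_mu_lincomb by assumption; unfold lincomb; ring.
- assumption.
Qed.

Lemma poisson_lincomb_r (f g g' : sfun) (x : C) : chart_diff g -> chart_diff g' ->
  chart_eq (poisson f (lincomb g x g')) (lincomb (poisson f g) x (poisson f g')).
Proof.
intros Hg Hg' lam mu H; unfold poisson.
rewrite d_lam_lincomb, d_mu_lincomb by assumption; unfold lincomb; ring.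
Qed.

Lemma poisson_lincomb_l (f f' g : sfun) (x : C) : chart_diff f -> chart_diff f' ->
  chart_eq (poisson (lincomb f x f') g) (lincomb (poisson f g) x (poisson f' g)).
Proof.
intros Hf Hf' lam mu H; unfold poisson.
rewrite d_lam_lincomb, d_mu_lincomb by assumption; unfold lincomb; ring.
Qed.

Lemma poisson_ext (f f' g g' : sfun) :
  chart_eq f f' -> chart_eq g g' -> chart_eq (poisson f g) (poisson f' g').
Proof.
intros Hf Hg lam mu H; unfold poisson.
rewrite (d_lam_ext _ _ Hf), (d_lam_ext _ _ Hg), (d_mu_ext _ _ Hf), (d_mu_ext _ _ Hg)
  by assumption; reflexivity.
Qed.

Lemma laplacian_ext (f g : sfun) : chart_eq f g -> chart_eq (laplacian f) (laplacian g).
Proof.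
intros H lam mu Hc; unfold laplacian.
rewrite (d_lam_ext _ _ (d_lam_ext _ _ H)) by assumption.
rewrite (d_mu_ext _ _ (weighted_d_mu_ext _ _ H)) by assumption; reflexivity.
Qed.

(** * Separated functions, modes, and the operators acting on them *)

Definition sep (c : C) (k : Z) (a : R -> R) : sfun :=
  fun lam mu => (c * RtoC (a mu) * expi (IZR k * lam))%C.

Lemma is_Cderive_sep_lam (c : C) (k : Z) (a : R -> R) (lam mu : R) :
  is_Cderive (fun s => sep c k a s mu) lam (sep (c * (0, IZR k))%C k a lam mu).
Proof.
unfold sep; replace (c * (0, IZR k) * RtoC (a mu) * expi (IZR k * lam))%C
  with (c * RtoC (a mu) * (0, IZR k) * expi (IZR k * lam))%C by ring.
apply is_Cderive_expi.
Qed.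

Lemma is_Cderive_sep_mu (c : C) (k : Z) (a a' : R -> R) (lam mu : R) :
  is_derive a mu (a' mu) ->
  is_Cderive (fun s => sep c k a lam s) mu (sep c k a' lam mu).
Proof.
intros Ha; unfold sep.
destruct (is_Cderive_real (c * expi (IZR k * lam))%C a mu _ Ha) as [H1 H2].
replace (c * RtoC (a' mu) * expi (IZR k * lam))%C
  with (c * expi (IZR k * lam) * RtoC (a' mu))%C by ring.
split; [revert H1 | revert H2]; apply is_derive_ext; intros t;
  f_equal; ring.
Qed.

Definition weight (k : Z) (mu : R) : R := Rpower (1 - mu ^ 2) (IZR (Z.abs k) / 2).

(** The derivative is kept as a multiple of the weight; the price is a denominator [1 - mu ^ 2],
    which the lemmas on modes have to cancel. *)
Lemma is_derive_weight (k : Z) (mu : R) : -1 < mu < 1 ->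
  is_derive (weight k) mu (weight k mu * (- IZR (Z.abs k) * mu / (1 - mu ^ 2))).
Proof.
intros H; assert (0 < 1 - mu ^ 2) by nra.
unfold weight, Rpower; auto_derive; [lra|].
replace (1 + - (mu * (mu * 1))) with (1 - mu ^ 2) by ring; field; lra.
Qed.

(* A mode of frequency [k] is [weight k * p] times [expi (k lam)] with [p] a polynomial in [mu].
   Frequency and exponent must match: without the factor [(1 - mu^2)^(|k|/2)],
   the Laplacian would be singular at the poles. *)
Definition is_mode (k : Z) (f : sfun) : Prop :=
  exists (c : C) (p : R -> R), is_poly p /\ chart_eq f (sep c k (fun mu => weight k mu * p mu)).

Lemma is_derive_weight_mult (k : Z) (p p' : R -> R) (mu : R) : -1 < mu < 1 ->
  is_derive p mu (p' mu) ->
  is_derive (fun t => weight k t * p t) mu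
    (weight k mu * (p' mu - IZR (Z.abs k) * mu * p mu / (1 - mu ^ 2))).
Proof.
intros H D.
replace (weight k mu * (p' mu - IZR (Z.abs k) * mu * p mu / (1 - mu ^ 2)))
  with (weight k mu * (- IZR (Z.abs k) * mu / (1 - mu ^ 2)) * p mu + weight k mu * p' mu)
  by (field; nra).
apply (is_derive_mult (K := R_AbsRing)); [apply is_derive_weight; assumption | assumption |].
intros; apply Rmult_comm.
Qed.

Lemma chart_diff_mode (k : Z) (f : sfun) : is_mode k f -> chart_diff f.
Proof.
intros (c & p & Hp & E) lam mu [Hl Hm].
destruct (is_poly_derive p Hp) as [p' [_ D]]; split.
- apply (ex_Cderive_ext_loc (fun s => sep c k (fun t => weight k t * p t) s mu)).
  + generalize (locally_between _ _ _ Hl); apply filter_imp; intros s Hs.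
    symmetry; apply E; split; assumption.
  + eapply is_Cderive_ex, is_Cderive_sep_lam.
- apply (ex_Cderive_ext_loc (fun s => sep c k (fun t => weight k t * p t) lam s)).
  + generalize (locally_between _ _ _ Hm); apply filter_imp; intros s Hs.
    symmetry; apply E; split; assumption.
  + eapply is_Cderive_ex, (is_Cderive_sep_mu _ _ _
      (fun t => weight k t * (p' t - IZR (Z.abs k) * t * p t / (1 - t ^ 2)))).
    apply is_derive_weight_mult; auto.
Qed.

Lemma is_mode_d_lam (k : Z) (f : sfun) : is_mode k f -> is_mode k (d_lam f).
Proof.
intros (c & p & Hp & E); exists (c * (0, IZR k))%C, p; split; [assumption|].
intros lam mu H; rewrite (d_lam_ext _ _ E) by assumption.
apply is_Cderive_unique, is_Cderive_sep_lam.
Qed.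

Lemma d_mu_sep_weight (c : C) (k : Z) (p p' : R -> R) :
  (forall t, is_derive p t (p' t)) ->
  chart_eq (d_mu (sep c k (fun mu => weight k mu * p mu)))
    (sep c k (fun t => weight k t * (p' t - IZR (Z.abs k) * t * p t / (1 - t ^ 2)))).
Proof.
intros D lam mu [_ H].
apply is_Cderive_unique, (is_Cderive_sep_mu _ _ _
  (fun t => weight k t * (p' t - IZR (Z.abs k) * t * p t / (1 - t ^ 2)))).
apply is_derive_weight_mult; auto.
Qed.

(** The factor [1 - mu ^ 2] clears the denominator left by the derivative of the weight, so a
    polynomial remains beside the weight. *)
Lemma weighted_d_mu_sep (c : C) (k : Z) (p p' : R -> R) :
  (forall t, is_derive p t (p' t)) ->
  chart_eq (weighted_d_mu (sep c k (fun mu => weight k mu * p mu)))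
    (sep c k (fun t => weight k t * ((1 + (-1) * t ^ 2) * p' t + (- IZR (Z.abs k)) * (t * p t)))).
Proof.
intros D lam mu H; unfold weighted_d_mu.
rewrite (d_mu_sep_weight _ _ _ _ D) by assumption; unfold sep.
assert (Hw := chart_weight_pos _ _ H).
replace (weight k mu * ((1 + (-1) * mu ^ 2) * p' mu + (- IZR (Z.abs k)) * (mu * p mu)))
  with ((1 - mu ^ 2) * (weight k mu * (p' mu - IZR (Z.abs k) * mu * p mu / (1 - mu ^ 2))))
  by (field; lra).
rewrite (RtoC_mult (1 - mu ^ 2)); ring.
Qed.

Lemma is_mode_weighted_d_mu (k : Z) (f : sfun) : is_mode k f -> is_mode k (weighted_d_mu f).
Proof.
intros (c & p & Hp & E).
destruct (is_poly_derive p Hp) as [p' [Hp' D]].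
exists c, (fun t => (1 + (-1) * t ^ 2) * p' t + (- IZR (Z.abs k)) * (t * p t)); split.
- apply is_poly_plus; apply is_poly_mult;
    [apply is_poly_one_minus_sqr | assumption | apply is_poly_const |].
  apply is_poly_mult; [apply is_poly_id | assumption].
- intros lam mu H; rewrite (weighted_d_mu_ext _ _ E) by assumption.
  apply weighted_d_mu_sep; assumption.
Qed.

Lemma IZR_abs_sqr (k : Z) : IZR (Z.abs k) * IZR (Z.abs k) = IZR k * IZR k.
Proof. rewrite <- !mult_IZR; f_equal; lia. Qed.

(** The longitude term contributes [- k^2 p / (1 - mu^2)], and differentiating the weight twice
    contributes [|k|^2 mu^2 p / (1 - mu^2)]. Their sum is [- k^2 p], so the poles cancel. *)
Lemma is_mode_laplacian (k : Z) (f : sfun) : is_mode k f -> is_mode k (laplacian f).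
Proof.
intros (c & p & Hp & E).
destruct (is_poly_derive p Hp) as [p' [Hp' D]].
(* [q] is the polynomial that [weighted_d_mu] puts in place of [p]. *)
set (q := fun t => (1 + (-1) * t ^ 2) * p' t + (- IZR (Z.abs k)) * (t * p t)).
assert (Hq : is_poly q).
{ apply is_poly_plus; apply is_poly_mult;
    [apply is_poly_one_minus_sqr | assumption | apply is_poly_const |].
  apply is_poly_mult; [apply is_poly_id | assumption]. }
destruct (is_poly_derive q Hq) as [q' [Hq' D']].
exists c, (fun t => q' t + (-1) * (IZR (Z.abs k) * (t * p' t) + IZR k * IZR k * p t)).
split; [repeat (assumption || constructor)|].
intros lam mu H; rewrite (laplacian_ext _ _ E) by assumption; unfold laplacian.
assert (E1 : chart_eq (d_lam (sep c k (fun mu => weight k mu * p mu)))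
               (sep (c * (0, IZR k))%C k (fun mu => weight k mu * p mu))).
{ intros l m _; apply is_Cderive_unique, is_Cderive_sep_lam. }
rewrite (d_lam_ext _ _ E1) by assumption.
change (d_lam (sep (c * (0, IZR k))%C k (fun mu => weight k mu * p mu)) lam mu)
  with (CDerive (fun s => sep (c * (0, IZR k))%C k (fun mu => weight k mu * p mu) s mu) lam).
rewrite (is_Cderive_unique _ _ _ (is_Cderive_sep_lam _ _ _ _ _)).
rewrite (d_mu_ext _ _ (weighted_d_mu_sep c k p p' D)) by assumption.
fold q; rewrite (d_mu_sep_weight _ _ _ _ D') by assumption; unfold sep.
assert (Hw := chart_weight_pos _ _ H).
replace (weight k mu * (q' mu + (-1) * (IZR (Z.abs k) * (mu * p' mu) + IZR k * IZR k * p mu)))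
  with (/ (1 - mu ^ 2) * (- (IZR k * IZR k)) * (weight k mu * p mu)
        + weight k mu * (q' mu - IZR (Z.abs k) * mu * q mu / (1 - mu ^ 2))).
- rewrite RtoC_plus, (RtoC_mult _ (weight k mu * p mu)), (RtoC_mult (/ _)).
  replace (RtoC (- (IZR k * IZR k))) with ((0, IZR k) * (0, IZR k))%C; [ring|].
  unfold Cmult, RtoC; simpl; f_equal; ring.
- unfold q; rewrite <- IZR_abs_sqr; field; lra.
Qed.

(** The weights carry half the absolute frequencies as exponents, so [j] is the excess of the
    exponents on the left over that of [weight (k + n)]. *)
Lemma weight_mult (k n : Z) (j : nat) (mu : R) :
  (Z.abs k + Z.abs n = Z.abs (k + n) + 2 * Z.of_nat j)%Z -> -1 < mu < 1 ->
  weight k mu * weight n mu = weight (k + n) mu * (1 - mu ^ 2) ^ j.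
Proof.
intros E H; unfold weight; rewrite <- (Rpower_pow j) by nra.
rewrite <- !Rpower_plus; f_equal; apply (f_equal IZR) in E.
rewrite !plus_IZR, mult_IZR, <- INR_IZR_INZ in E; lra.
Qed.

Lemma is_mode_poisson (k n : Z) (f g : sfun) :
  is_mode k f -> is_mode n g -> is_mode (k + n) (poisson f g).
Proof.
intros (c & p & Hp & Ef) (d & q & Hq & Eg).
destruct (is_poly_derive p Hp) as [p' [Hp' Dp]].
destruct (is_poly_derive q Hq) as [q' [Hq' Dq]].
(* The bracket has radial part [weight k * weight n * (k p q' - n q p' - b t p q / (1 - t^2))] with
   [b = k |n| - n |k|].  If [k] and [n] have opposite signs the product of weights exceeds
   [weight (k + n)] by a positive power of [1 - t^2], and otherwise [b = 0]. *)
set (b := IZR k * IZR (Z.abs n) - IZR n * IZR (Z.abs k)).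
assert (Hj : exists r, is_poly r /\ forall t, -1 < t < 1 ->
  weight (k + n) t * r t = weight k t * weight n t *
    (IZR k * (p t * q' t) + (- IZR n) * (q t * p' t) - b * t * p t * q t / (1 - t ^ 2))).
{ set (j := Z.to_nat ((Z.abs k + Z.abs n - Z.abs (k + n)) / 2)).
  assert (Ej : (Z.abs k + Z.abs n = Z.abs (k + n) + 2 * Z.of_nat j)%Z).
  { unfold j; rewrite Z2Nat.id by (apply Z.div_pos; lia).
    (* The excess is even: each sign pattern has an explicit half. *)
    assert (exists z, Z.abs k + Z.abs n - Z.abs (k + n) = z * 2)%Z as [z Hz].
    { destruct (Z.abs_spec k) as [[_ ->]|[_ ->]], (Z.abs_spec n) as [[_ ->]|[_ ->]],
        (Z.abs_spec (k + n)) as [[_ ->]|[_ ->]];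
      [exists 0%Z | exists (k + n)%Z | exists (-n)%Z | exists k | exists (-k)%Z
       | exists n | exists (-k-n)%Z | exists 0%Z]; ring. }
    rewrite Hz, Z.div_mul by lia; lia. }
  clearbody j; destruct j as [|j].
  (* No excess means [|k| + |n| = |k + n|], which forces [b = 0]. *)
  - exists (fun t => IZR k * (p t * q' t) + (- IZR n) * (q t * p' t)).
    split; [repeat (assumption || constructor)|]; intros t Ht.
    rewrite (weight_mult k n 0) by assumption.
    replace b with 0; [simpl; field; nra|].
    unfold b; rewrite <- !mult_IZR, <- minus_IZR; f_equal; nia.
  (* One of the [S j] factors [1 - t ^ 2] clears the denominator; the other [j] stay in front. *)
  - exists (fun t => (1 + (-1) * t ^ 2) ^ j * ((1 + (-1) * t ^ 2)
      * (IZR k * (p t * q' t) + (- IZR n) * (q t * p' t)) + (- b) * (t * (p t * q t)))).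
    split.
    + apply is_poly_mult; [apply is_poly_pow, is_poly_one_minus_sqr|].
      apply is_poly_plus; [apply is_poly_mult; [apply is_poly_one_minus_sqr|] |];
        repeat (assumption || constructor).
    + intros t Ht; rewrite (weight_mult k n (S j)) by assumption.
      replace (1 + (-1) * t ^ 2) with (1 - t ^ 2) by ring.
      change ((1 - t ^ 2) ^ S j) with ((1 - t ^ 2) * (1 - t ^ 2) ^ j); field; nra. }
destruct Hj as [r [Hr Er]].
(* Each term of the bracket has exactly one longitude derivative. Its factor [i] goes into the
   constant, while [k] and [n] are already in [r]. *)
exists (c * d * (0, 1))%C, r; split; [assumption|].
intros lam mu H; rewrite (poisson_ext _ _ _ _ Ef Eg) by assumption; unfold poisson.
rewrite !(d_mu_sep_weight _ _ _ _ Dp), !(d_mu_sep_weight _ _ _ _ Dq) by assumption.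
assert (Hl : forall z m a, d_lam (sep z m a) lam mu = sep (z * (0, IZR m))%C m a lam mu).
{ intros; apply is_Cderive_unique, is_Cderive_sep_lam. }
rewrite !Hl; unfold sep.
rewrite Er by apply H.
replace (expi (IZR (k + n) * lam)) with (expi (IZR k * lam) * expi (IZR n * lam))%C.
2:{ unfold expi, Cmult; simpl.
    rewrite plus_IZR, Rmult_plus_distr_r, cos_plus, sin_plus; f_equal; ring. }
assert (Hw := chart_weight_pos _ _ H).
(* With the radial parts and their derivatives as atoms, the bracket becomes a polynomial identity
   for [ring]. *)
set (P := weight k mu * p mu); set (Q := weight n mu * q mu).
set (P' := weight k mu * (p' mu - _)); set (Q' := weight n mu * (q' mu - _)).
replace (weight k mu * weight n mu * _) with (IZR k * P * Q' - IZR n * Q * P').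
- rewrite RtoC_minus, !RtoC_mult.
  replace (0, IZR k) with (RtoC (IZR k) * (0, 1))%C
    by (unfold Cmult, RtoC; simpl; f_equal; ring).
  replace (0, IZR n) with (RtoC (IZR n) * (0, 1))%C
    by (unfold Cmult, RtoC; simpl; f_equal; ring).
  ring.
- unfold P, Q, P', Q', b; field; lra.
Qed.

(** * Spherical harmonics are modes *)

Lemma is_mode_Ynonneg (l m : nat) : is_mode (Z.of_nat m) (Ynonneg l m).
Proof.
destruct (is_poly_Derive_n (fun t => (t ^ 2 - 1) ^ l) (l + m)) as [q [Hq E]].
{ apply is_poly_pow, (is_poly_plus (fun t => t ^ 2) (fun _ => -1));
    [apply is_poly_pow|]; constructor. }
(* The constant collects the normalisation and the factor [1 / (2^l l!)] of the Rodrigues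
   formula. *)
eexists (RtoC ((-1) ^ m
         * sqrt ((2 * INR l + 1) / (4 * PI)
                 * (INR (fact (l - m)) / INR (fact (l + m)))) / (2 ^ l * INR (fact l)))), q.
split; [assumption|]; intros lam mu H; unfold Ynonneg, legendre, sep, weight.
rewrite E, Z.abs_eq, <- INR_IZR_INZ by lia.
rewrite <- RtoC_mult; f_equal; f_equal; unfold Rdiv; ring.
Qed.

(** Conjugation reverses the exponential, and the weight depends on [|k|] only. The scalar [x] makes
    room for the sign in the definition of [Y] at negative orders. *)
Lemma is_mode_conj (k : Z) (f : sfun) (x : C) :
  is_mode k f -> is_mode (- k) (fun lam mu => (x * Cconj (f lam mu))%C).
Proof.
intros (c & p & Hp & E); exists (x * Cconj c)%C, p; split; [assumption|].
intros lam mu H; rewrite E by assumption; unfold sep, weight.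
rewrite Z.abs_opp, opp_IZR, !Cmult_conj.
replace (expi (- IZR k * lam)) with (Cconj (expi (IZR k * lam))).
- replace (Cconj (RtoC _)) with (RtoC (Rpower (1 - mu ^ 2) (IZR (Z.abs k) / 2) * p mu)); [ring|].
  unfold Cconj, RtoC; simpl; f_equal; ring.
- unfold Cconj, expi; simpl; rewrite Ropp_mult_distr_l_reverse, cos_neg, sin_neg; reflexivity.
Qed.

Lemma is_mode_Y (l : nat) (m : Z) : is_mode m (Y l m).
Proof.
unfold Y; destruct (Z.leb_spec 0 m) as [H|H].
- rewrite <- (Z.abs_eq m) at 1 by assumption; rewrite <- Zabs2Nat.id_abs.
  apply is_mode_Ynonneg.
- replace m with (- Z.of_nat (Z.abs_nat m))%Z at 1 by lia.
  apply is_mode_conj, is_mode_Ynonneg.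
Qed.

(** * Integration over the sphere and orthogonality of modes *)

(** Records integrability along with the value, since the total [RInt] is additive only on
    integrable functions. [I] is the longitude integral as a function of the height. *)
Definition is_sphere_int (h : sfun) (v : C) : Prop :=
  exists I : R -> C,
    (forall mu, -1 < mu < 1 ->
       is_RInt (V := C_R_NormedModule) (fun lam => h lam mu) 0 (2 * PI) (I mu))
    /\ is_RInt (V := C_R_NormedModule) I (-1) 1 v.

Lemma is_sphere_int_unique (h : sfun) (v : C) : is_sphere_int h v -> sphere_int h = v.
Proof.
intros (I & H1 & H2); unfold sphere_int.
apply (is_RInt_unique (V := C_R_CompleteNormedModule)).
apply (is_RInt_ext (V := C_R_NormedModule) I); [|assumption].
rewrite Rmin_left, Rmax_right by lra; intros mu H.
symmetry; apply (is_RInt_unique (V := C_R_CompleteNormedModule)); auto.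
Qed.

Lemma is_sphere_int_ext (f g : sfun) (v : C) :
  chart_eq f g -> is_sphere_int f v -> is_sphere_int g v.
Proof.
intros E (I & H1 & H2); exists I; split; [|assumption]; intros mu H.
apply (is_RInt_ext (V := C_R_NormedModule) (fun lam => f lam mu)); [|auto].
assert (HP := PI_RGT_0); rewrite Rmin_left, Rmax_right by lra.
intros lam Hl; apply E; split; assumption.
Qed.

Lemma is_sphere_int_plus (f g : sfun) (u v : C) : is_sphere_int f u -> is_sphere_int g v ->
  is_sphere_int (fun lam mu => (f lam mu + g lam mu)%C) (u + v)%C.
Proof.
intros (I & H1 & H2) (J & H3 & H4); exists (fun mu => (I mu + J mu)%C); split.
- intros mu H; apply (is_RInt_plus (V := C_R_NormedModule)); auto.
- apply (is_RInt_plus (V := C_R_NormedModule)); auto.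
Qed.

Lemma is_RInt_C (f : R -> C) (a b : R) (v : C) :
  is_RInt (fun t => Re (f t)) a b (Re v) -> is_RInt (fun t => Im (f t)) a b (Im v) ->
  is_RInt (V := C_R_NormedModule) f a b v.
Proof.
intros H1 H2; destruct v as [p q].
apply (is_RInt_fct_extend_pair (U := R_NormedModule) (V := R_NormedModule)); assumption.
Qed.

Lemma is_sphere_int_sep0 (c : C) (a : R -> R) (v : R) :
  is_RInt a (-1) 1 v -> is_sphere_int (sep c 0 a) (c * RtoC (2 * PI * v))%C.
Proof.
intros Ha; exists (fun mu => (c * RtoC (2 * PI * a mu))%C); split.
- intros mu _.
  apply (is_RInt_ext (V := C_R_NormedModule) (fun _ => (c * RtoC (a mu))%C)).
  { intros lam _; unfold sep, expi; rewrite Rmult_0_l, cos_0, sin_0.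
    symmetry; apply Cmult_1_r. }
  replace (c * RtoC (2 * PI * a mu))%C
    with (scal (V := C_R_NormedModule) (2 * PI - 0) (c * RtoC (a mu))%C).
  + apply (is_RInt_const (V := C_R_NormedModule)).
  + destruct c as [p q]; unfold scal; simpl; unfold prod_scal, scal; simpl.
    unfold mult, Cmult; simpl; f_equal; ring.
- destruct c as [p q]; apply is_RInt_C; simpl.
  + apply (is_RInt_ext (V := R_NormedModule) (fun t => scal (2 * PI * p) (a t))).
    { intros; unfold scal; simpl; unfold mult; simpl; ring. }
    replace (p * (2 * PI * v) - q * 0) with (scal (V := R_NormedModule) (2 * PI * p) v)
      by (unfold scal; simpl; unfold mult; simpl; ring).
    apply (is_RInt_scal (V := R_NormedModule)); assumption.
  + apply (is_RInt_ext (V := R_NormedModule) (fun t => scal (2 * PI * q) (a t))).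
    { intros; unfold scal; simpl; unfold mult; simpl; ring. }
    replace (p * 0 + q * (2 * PI * v)) with (scal (V := R_NormedModule) (2 * PI * q) v)
      by (unfold scal; simpl; unfold mult; simpl; ring).
    apply (is_RInt_scal (V := R_NormedModule)); assumption.
Qed.

Lemma is_RInt_primitive (F f : R -> R) (a b : R) :
  (forall t, is_derive F t (f t)) -> (forall t, continuous f t) -> F b = F a ->
  is_RInt f a b 0.
Proof.
intros D Hc E; replace 0 with (minus (F b) (F a)).
- apply (is_RInt_derive (V := R_CompleteNormedModule)); auto.
- rewrite E; apply (minus_eq_zero (G := R_AbelianGroup)).
Qed.

Lemma cos_sin_2kPI (k : Z) : cos (IZR k * (2 * PI)) = 1 /\ sin (IZR k * (2 * PI)) = 0.
Proof.
replace (IZR k * (2 * PI)) with (2 * (IZR k * PI)) by ring.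
rewrite cos_2a_sin, sin_2a, (sin_eq_0_1 (IZR k * PI)) by (exists k; reflexivity).
split; ring.
Qed.

Lemma is_sphere_int_sep (c : C) (k : Z) (a : R -> R) :
  k <> 0%Z -> is_sphere_int (sep c k a) 0%C.
Proof.
intros Hk; apply not_0_IZR in Hk; exists (fun _ => 0%C); split.
- intros mu _; unfold sep; destruct (cos_sin_2kPI k) as [Ec Es].
  destruct (c * RtoC (a mu))%C as [p q]; apply is_RInt_C.
  (* The primitives here and in the next case are the real and imaginary parts of
     [(p + i q) exp(i k t) / (i k)], which has period [2 PI]. *)
  + apply (is_RInt_primitive
      (fun t => (p * sin (IZR k * t) + q * cos (IZR k * t)) / IZR k)).
    * intros t; simpl; auto_derive; [auto|]; field; assumption.
    * intros t; apply (ex_derive_continuous (K := R_AbsRing) (V := R_NormedModule)).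
      simpl; auto_derive; auto.
    * rewrite Ec, Es, (Rmult_0_r (IZR k)), cos_0, sin_0; reflexivity.
  + apply (is_RInt_primitive
      (fun t => (- p * cos (IZR k * t) + q * sin (IZR k * t)) / IZR k)).
    * intros t; simpl; auto_derive; [auto|]; field; assumption.
    * intros t; apply (ex_derive_continuous (K := R_AbsRing) (V := R_NormedModule)).
      simpl; auto_derive; auto.
    * rewrite Ec, Es, (Rmult_0_r (IZR k)), cos_0, sin_0; reflexivity.
- apply is_RInt_C; simpl;
    apply (is_RInt_primitive (fun _ => 0));
    try (intros; apply continuous_const); try reflexivity;
    intros; apply (is_derive_const (V := R_NormedModule)).
Qed.

Lemma sep_mult_conj (c d : C) (k n : Z) (a b : R -> R) (lam mu : R) :
  (sep c k a lam mu * Cconj (sep d n b lam mu))%C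
  = sep (c * Cconj d)%C (k - n) (fun t => a t * b t) lam mu.
Proof.
unfold sep; rewrite !Cmult_conj.
replace (expi (IZR (k - n) * lam)) with (expi (IZR k * lam) * Cconj (expi (IZR n * lam)))%C.
- replace (Cconj (RtoC (b mu))) with (RtoC (b mu))
    by (unfold Cconj, RtoC; simpl; f_equal; ring).
  rewrite RtoC_mult; ring.
- unfold expi, Cconj, Cmult; simpl.
  rewrite minus_IZR, Rmult_minus_distr_r, cos_minus, sin_minus; f_equal; ring.
Qed.

(** The exponentials cancel and the two weights multiply to [(1 - mu^2)^|k|], so the integrand is a
    polynomial in [mu]. [v] is fixed before [x], so that one value serves every scalar multiple. *)
Lemma is_sphere_int_mode (k : Z) (f g : sfun) : is_mode k f -> is_mode k g ->
  exists v, forall x : C,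
    is_sphere_int (fun lam mu => (x * (f lam mu * Cconj (g lam mu)))%C) (x * v)%C.
Proof.
intros (c & p & Hp & Ef) (d & q & Hq & Eg).
set (a := fun mu => weight k mu * p mu * (weight k mu * q mu)).
(* Only the open interval is claimed: at the end points the base of [Rpower] is [0], where it takes
   a default value. Integrability does not see these points. *)
assert (Ea : forall t, -1 < t < 1 -> (1 + (-1) * t ^ 2) ^ Z.abs_nat k * (p t * q t) = a t).
{ intros t Ht; unfold a, weight.
  replace (1 + (-1) * t ^ 2) with (1 - t ^ 2) by ring.
  rewrite <- (Rpower_pow (Z.abs_nat k)) by nra.
  rewrite INR_IZR_INZ, Zabs2Nat.id_abs.
  replace (IZR (Z.abs k)) with (IZR (Z.abs k) / 2 + IZR (Z.abs k) / 2) at 1 by field.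
  rewrite Rpower_plus; ring. }
assert (Ha : ex_RInt a (-1) 1).
{ apply (ex_RInt_ext (V := R_NormedModule)
    (fun t => (1 + (-1) * t ^ 2) ^ Z.abs_nat k * (p t * q t))).
  - rewrite Rmin_left, Rmax_right by lra; exact Ea.
  - apply ex_RInt_poly, is_poly_mult; [apply is_poly_pow, is_poly_one_minus_sqr|].
    constructor; assumption. }
destruct Ha as [v Hv]; exists (c * Cconj d * RtoC (2 * PI * v))%C; intros x.
apply (is_sphere_int_ext (sep (x * (c * Cconj d))%C 0 a)).
- intros lam mu H; rewrite Ef, Eg, sep_mult_conj by assumption.
  rewrite Z.sub_diag; unfold sep, a; ring.
- replace (x * (c * Cconj d * RtoC (2 * PI * v)))%C
    with (x * (c * Cconj d) * RtoC (2 * PI * v))%C by ring.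
  apply is_sphere_int_sep0; assumption.
Qed.

Lemma is_sphere_int_mode_orthogonal (k n : Z) (f g : sfun) (x : C) :
  k <> n -> is_mode k f -> is_mode n g ->
  is_sphere_int (fun lam mu => (x * (f lam mu * Cconj (g lam mu)))%C) 0%C.
Proof.
intros Hkn (c & p & _ & Ef) (d & q & _ & Eg).
apply (is_sphere_int_ext (sep (x * (c * Cconj d))%C (k - n)
  (fun mu => weight k mu * p mu * (weight n mu * q mu)))).
- intros lam mu H; rewrite Ef, Eg, sep_mult_conj by assumption; unfold sep; ring.
- apply is_sphere_int_sep; lia.
Qed.

(** * Splitting of the inner products and of the Misiolek criterion *)

Lemma Cmult_conj_self (x : C) : (x * Cconj x)%C = RtoC (Cmod x ^ 2).
Proof.
destruct x as [a b]; unfold Cmod, Cmult, Cconj, RtoC; simpl fst; simpl snd.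
rewrite pow2_sqrt by nra; f_equal; ring.
Qed.

Lemma inner_lincomb_mode (k n : Z) (f f' g g' : sfun) (x : C) :
  k <> n -> is_mode k f -> is_mode k f' -> is_mode n g -> is_mode n g' ->
  inner (lincomb f x g) (lincomb f' x g')
  = (inner f f' + RtoC (Cmod x ^ 2) * inner g g')%C.
Proof.
intros Hkn Hf Hf' Hg Hg'.
destruct (is_sphere_int_mode k f f' Hf Hf') as [u Hu].
destruct (is_sphere_int_mode n g g' Hg Hg') as [v Hv].
assert (Hone : forall h h' w,
  (forall z : C, is_sphere_int (fun lam mu => (z * (h lam mu * Cconj (h' lam mu)))%C) (z * w)%C) ->
  inner h h' = w).
{ intros h h' w Hw; unfold inner; apply is_sphere_int_unique; rewrite <- (Cmult_1_l w).
  apply (is_sphere_int_ext (fun lam mu => (1 * (h lam mu * Cconj (h' lam mu)))%C)); [|apply Hw].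
  intros lam mu _; ring. }
rewrite (Hone _ _ _ Hu), (Hone _ _ _ Hv), <- Cmult_conj_self.
unfold inner; apply is_sphere_int_unique.
(* One summand per product of the expansion: the diagonal ones with scalars [1] and [x * Cconj x],
   then the mixed ones with [Cconj x] and [x], which integrate to [0]. *)
replace (u + x * Cconj x * v)%C with (1 * u + (x * Cconj x * v) + (0 + 0))%C by ring.
eapply is_sphere_int_ext;
  [|apply is_sphere_int_plus; apply is_sphere_int_plus;
    [apply Hu | apply Hv
    | apply (is_sphere_int_mode_orthogonal k n f g' (Cconj x)); assumption
    | apply (is_sphere_int_mode_orthogonal n k g f' x); auto]].
intros lam mu _; unfold lincomb; simpl; rewrite Cplus_conj, Cmult_conj; ring.
Qed.

Lemma is_stream_lincomb (f g : sfun) (u v : vfield) (x : C) :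
  is_stream f u -> is_stream g v -> is_stream (lincomb f x g) (vadd u (vscal x v)).
Proof.
intros [Hf Eu] [Hg Ev]; split; [apply chart_diff_lincomb; assumption|].
intros lam mu H; unfold vadd, vscal; rewrite Eu, Ev by assumption.
unfold gradperp; simpl; rewrite d_lam_lincomb, d_mu_lincomb by assumption.
unfold lincomb; f_equal; ring.
Qed.

Lemma is_stream_e (l : nat) (m : Z) : is_stream (Y l m) (e l m).
Proof. split; [apply (chart_diff_mode m), is_mode_Y | reflexivity]. Qed.

Lemma inner_ext (f f' g g' : sfun) : chart_eq f f' -> chart_eq g g' -> inner f g = inner f' g'.
Proof.
intros Hf Hg; unfold inner; apply sphere_int_ext; intros lam mu H; rewrite Hf, Hg by assumption; reflexivity.
Qed.

(** Common core of both claims, with [P] in the role of [{f, g}] and [Q] in that of [{Delta f, g}].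
    Their expansions enter as hypotheses, so linearity in either slot of the bracket can supply
    them. *)
Lemma inner_split (k n : Z) (p1 p2 q1 q2 P Q : sfun) (x : C) :
  k <> n -> is_mode k p1 -> is_mode n p2 -> is_mode k q1 -> is_mode n q2 ->
  chart_eq P (lincomb p1 x p2) -> chart_eq Q (lincomb q1 x q2) ->
  (inner (laplacian P) P - inner Q P)%C
  = (inner (laplacian p1) p1 - inner q1 p1
     + RtoC (Cmod x ^ 2) * (inner (laplacian p2) p2 - inner q2 p2))%C.
Proof.
intros Hkn Hp1 Hp2 Hq1 Hq2 EP EQ.
assert (EL : chart_eq (laplacian P) (lincomb (laplacian p1) x (laplacian p2))).
{ intros lam mu H; rewrite (laplacian_ext _ _ EP) by assumption.
  apply laplacian_lincomb; try assumption;
    eauto using chart_diff_mode, is_mode_d_lam, is_mode_weighted_d_mu. }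
rewrite (inner_ext _ _ _ _ EL EP), (inner_ext _ _ _ _ EQ EP).
rewrite !(inner_lincomb_mode k n) by auto using is_mode_laplacian; ring.
Qed.

Theorem proposition3p3
  (l1 l1' l2 l2' : nat) (x : C) (m1 m1' m2 m2' : Z)
  (h1 : (Z.abs m1 <= Z.of_nat l1)%Z) (h1' : (Z.abs m1' <= Z.of_nat l1')%Z)
  (h2 : (Z.abs m2 <= Z.of_nat l2)%Z) (h2' : (Z.abs m2' <= Z.of_nat l2')%Z) :
  (m2 <> m2' ->
     MC (e l1 m1) (vadd (e l2 m2) (vscal x (e l2' m2')))
     = (MC (e l1 m1) (e l2 m2)
        + RtoC (Cmod x ^ 2) * MC (e l1 m1) (e l2' m2'))%C)
  /\
  (m1 <> m1' ->
     MC (vadd (e l1 m1) (vscal x (e l1' m1'))) (e l2 m2)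
     = (MC (e l1 m1) (e l2 m2)
        + RtoC (Cmod x ^ 2) * MC (e l1' m1') (e l2 m2))%C).
Proof.
assert (Hd : forall l m, chart_diff (Y l m)).
{ intros l m; apply (chart_diff_mode m), is_mode_Y. }
split; intros Hm.
- rewrite (MC_streamE _ _ _ _ (is_stream_e l1 m1)
    (is_stream_lincomb _ _ _ _ x (is_stream_e l2 m2) (is_stream_e l2' m2'))).
  rewrite !(MC_streamE _ _ _ _ (is_stream_e _ _) (is_stream_e _ _)); unfold MC_stream.
  (* The brackets with the two summands have these frequencies, distinct since [m2 <> m2']. *)
  apply (inner_split (m1 + m2) (m1 + m2')); try lia;
    try (apply is_mode_poisson; auto using is_mode_laplacian, is_mode_Y);
    apply poisson_lincomb_r; apply Hd.
- rewrite (MC_streamE _ _ _ _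
    (is_stream_lincomb _ _ _ _ x (is_stream_e l1 m1) (is_stream_e l1' m1')) (is_stream_e l2 m2)).
  rewrite !(MC_streamE _ _ _ _ (is_stream_e _ _) (is_stream_e _ _)); unfold MC_stream.
  apply (inner_split (m1 + m2) (m1' + m2)); try lia;
    try (apply is_mode_poisson; auto using is_mode_laplacian, is_mode_Y).
  + apply poisson_lincomb_l; apply Hd.
  (* Here the combination also sits under the Laplacian, so linearity of the Laplacian is needed
     besides that of the bracket in its left slot. *)
  + intros lam mu H.
    rewrite <- poisson_lincomb_l;
      eauto using chart_diff_mode, is_mode_laplacian, is_mode_Y.
    apply poisson_ext; [|intros ? ? _; reflexivity | assumption].
    apply laplacian_lincomb;
      eauto using chart_diff_mode, is_mode_d_lam, is_mode_weighted_d_mu, is_mode_Y.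
Qed.
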